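(* Let $n\in\mathbb{N}$, $N\in\mathbb{Z}_+$, let $X\subseteq\mathbb{R}^n$ be open, and let $G\colon X\times U\to X$ be such that for every $w\in U$ the map $G(\cdot,w)$ is a $C^1$-diffeomorphism onto an open subset of $X$. Let $\psi$ be the general solution of $x_{k+1}=G(x_k,u_k)$. Assume that $U$ is finite; that $C$ is a finite covering of $\mathbb{R}^n$ whose elements are nonempty convex polyhedra; and that $C'\subseteq C$ is such that to each $\Delta\in C'$ there is assigned a superset $\widehat\Delta\supseteq\Delta$ with $\widehat\Delta\subseteq X$ for which $\psi(k,\widehat\Delta,u)$ is convex for all $k\in[1;N]$ and all $u\colon[0;k[\,\to U$. For each $\Delta\in C'$ let $\Sigma(\widehat\Delta)$ be a supporting polyhedral approximation of $\widehat\Delta$. Let $$S\colon \bigcup_{k=0}^N U^{[0;k[}\times C^{[0;k]}\to\mathcal{P}(\mathbb{R}^n\times\mathbb{R}^n)$$ be the map defined by the output of the algorithm given in the context. Then, for all $k\in[0;N]$, the set $$B_k=\left\{(u,\Delta)\in(U\times C)^{\mathbb{Z}_+}\;\middle|\;\forall_{\tau\in\mathbb{Z}_+}\; P\big(S(u|_{[\tau;\tau+k[},\Delta|_{[\tau;\tau+k]})\big)\neq\emptyset\right\}$$ is a $k$-complete discrete abstraction of the behavior of the quantized system $x_{k+1}=G(x_k,u_k)$, $\Delta_k\in Q(x_k)$.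
   Context: Notation: $\mathbb{Z}_+=\{0,1,2,\dots\}$, $\mathbb{N}=\{1,2,\dots\}$; $[a;b]$, $[a;b[$ denote the sets of integers $j$ with $a\le j\le b$, resp. $a\le j<b$. $\mathcal{P}(\cdot)$ is the power set; $A^*$ is the transpose of $A$; $\langle\cdot,\cdot\rangle$ is the standard inner product. Finite sequences indexed by $[\tau;\tau+k[$ or $[\tau;\tau+k]$ are identified with sequences indexed from $0$ by shifting. A convex polyhedron is a finite intersection of closed half-spaces. General solution: $\psi(0,x_0,u)=x_0$, $\psi(k+1,x_0,u)=G(\psi(k,x_0,u),u_k)$; only $u_0,\dots,u_{k-1}$ matter for $\psi(k,x_0,u)$. Set arguments are understood pointwise: $\psi(k,\Omega,u)=\{\psi(k,x,u): x\in\Omega\}$. Quantizer and behaviors: $Q(x)=\{\Delta\in C: x\in\Delta\}$. The behavior of the quantized system is the set of all $(u,\Delta)\colon\mathbb{Z}_+\to U\times C$ for which there is a sequence $x\colon\mathbb{Z}_+\to X$ with $x_{k+1}=G(x_k,u_k)$ and $\Delta_k\in Q(x_k)$ for all $k\in\mathbb{Z}_+$. For a set $W$, any $B\subseteq W^{\mathbb{Z}_+}$ is a behavior on $W$; $B|_I=\{w|_I: w\in B\}$; $(\sigma^\tau w)_k=w_{\tau+k}$. $B$ is $N$-complete if $B=\{w\in W^{\mathbb{Z}_+}:\forall_{\tau\in\mathbb{Z}_+}\,(\sigma^\tau w)|_{[0;N]}\in B|_{[0;N]}\}$. An abstraction of $B$ is a superset $B'\subseteq W^{\mathbb{Z}_+}$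 of $B$; it is discrete if it can be realized by a finite automaton (i.e., it is the set of all infinite label sequences generated by some automaton with finitely many states and transitions labelled by elements of $W$). Polyhedra: $P(p,v)=\{x\in\mathbb{R}^n:\langle v,x-p\rangle\le 0\}$ for $p,v\in\mathbb{R}^n$, and $P(\Sigma)=\bigcap_{(p,v)\in\Sigma}P(p,v)$ for $\Sigma\subseteq\mathbb{R}^n\times\mathbb{R}^n$ (so $P(\emptyset)=\mathbb{R}^n$). A vector $v$ is normal to $\Omega\subseteq\mathbb{R}^n$ at a boundary point $p$ of $\Omega$ if $\langle v,x-p\rangle\le0$ for all $x\in\Omega$. $\Sigma$ is a supporting convex approximation of $\Omega$ if $p\in\Omega$ and $v$ is normal to $\Omega$ at $p$ for all $(p,v)\in\Sigma$; it is a supporting polyhedral approximation if in addition $\Sigma$ is finite. Complementary extension: for a $C^1$-diffeomorphism $\Phi\colon V\to W$ between open subsets of $\mathbb{R}^n$, $\Phi^{\lozenge}\colon V\times\mathbb{R}^n\to W\times\mathbb{R}^n$, $\Phi^{\lozenge}(p,v)=(\Phi(p),(\Phi'(p)^{-1})^*v)$. $G(\cdot,w)^\lozenge$ denotes the complementary extension of $G(\cdot,w)$, and the image of a set under it means the image of the part of the set contained in its domain $X\times\mathbb{R}^n$. Algorithm defining $S$. Initialization: for $\Delta_0\in C$ (the case $k=0$), $S(\Delta_0)=\Sigma(\widehat\Delta_0)$ if $\Delta_0\in C'$ and $S(\Delta_0)=\emptyset$ otherwise. Recursion: for $k=0,\dots,N-1$ and all $u\colon[0;k+1[\,\to U$,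 $\Delta\colon[0;k+1]\to C$, put $S^-=S(u|_{[0;k[},\Delta|_{[0;k]})$ and let (1) $S(u,\Delta)=\emptyset$ if $S^-=\emptyset$; (2) otherwise, $S(u,\Delta)=\mathbb{R}^n\times\mathbb{R}^n$ if $\Delta_{k+1}\cap P(G(\cdot,u_k)^\lozenge(S^-))=\emptyset$; (3) otherwise, $S(u,\Delta)=\emptyset$ if $\Delta_{k+1}\notin C'$; (4) otherwise, $S(u,\Delta)=\Sigma(\widehat\Delta_{k+1})\cup G(\cdot,u_k)^\lozenge(S^-)$. *)

(* Defs.v *)
From HB Require Import structures.
From mathcomp Require Import all_boot all_order all_algebra.
From mathcomp Require Import all_classical all_reals all_analysis.

Set Implicit Arguments.
Unset Strict Implicit.
Unset Printing Implicit Defensive.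

Import Order.TTheory GRing.Theory Num.Theory.
Import numFieldNormedType.Exports.

Local Open Scope classical_set_scope.
Local Open Scope ring_scope.

(* Sequences and behaviors.  [initseg m w] is w restricted to [0;m[, so
   w|_[0;N] is [initseg N.+1 w]. *)
Definition initseg (T : Type) (m : nat) (w : nat -> T) : 'I_m -> T :=
  fun i => w i.
Arguments initseg {T} m w.

Definition seqshift (T : Type) (tau : nat) (w : nat -> T) : nat -> T :=
  fun k => w (tau + k)%N.

Definition complete (W : Type) (N : nat) (B : set (nat -> W)) : Prop :=
  B = [set w | forall tau : nat,
                 (initseg N.+1 @` B) (initseg N.+1 (seqshift tau w))].

Definition abstraction (W : Type) (B B' : set (nat -> W)) : Prop := B `<=` B'.

Record automaton (W : Type) := Automaton {
  state : finType;
  initial : set state;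
  transition : state -> W -> state -> Prop }.

Definition generated (W : Type) (A : automaton W) : set (nat -> W) :=
  [set w | exists q : nat -> state A,
     initial (q 0) /\ forall k, transition (q k) (w k) (q k.+1)].

Definition discrete (W : Type) (B : set (nat -> W)) : Prop :=
  exists A : automaton W, B = generated A.

(* Polyhedra in R^n, whose points are row vectors. *)
Definition dot (R : realType) (n : nat) (u v : 'rV[R]_n) : R :=
  \sum_(i < n) u 0 i * v 0 i.

Definition halfspace (R : realType) (n : nat) (p v : 'rV[R]_n) :
    set 'rV[R]_n :=
  [set x | dot v (x - p) <= 0].

Definition halfspaces (R : realType) (n : nat)
    (Sigma : set ('rV[R]_n * 'rV[R]_n)) : set 'rV[R]_n :=
  \bigcap_(pv in Sigma) halfspace pv.1 pv.2.

(* [halfspace p v] is a genuine half-space only if v is nonzero.  The whole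
   space, as the empty intersection, is a polyhedron. *)
Definition convex_polyhedron (R : realType) (n : nat) (A : set 'rV[R]_n) :
    Prop :=
  exists Sigma : set ('rV[R]_n * 'rV[R]_n),
    [/\ finite_set Sigma,
        forall pv, Sigma pv -> pv.2 != 0
      & A = halfspaces Sigma].

Definition boundary (T : topologicalType) (A : set T) : set T :=
  closure A `\` interior A.

Definition normal_at (R : realType) (n : nat) (Omega : set 'rV[R]_n)
    (p v : 'rV[R]_n) : Prop :=
  boundary Omega p /\ forall x, Omega x -> dot v (x - p) <= 0.

Definition supporting_convex_approx (R : realType) (n : nat)
    (Omega : set 'rV[R]_n) (Sigma : set ('rV[R]_n * 'rV[R]_n)) : Prop :=
  forall p v, Sigma (p, v) -> Omega p /\ normal_at Omega p v.

Definition supporting_polyhedral_approx (R : realType) (n : nat)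
    (Omega : set 'rV[R]_n) (Sigma : set ('rV[R]_n * 'rV[R]_n)) : Prop :=
  supporting_convex_approx Omega Sigma /\ finite_set Sigma.

(* Meant for open A: values of f outside A are then irrelevant, and continuity
   of the Jacobian at the points of A is continuity of f' on A. *)
Definition C1_on (R : realType) (n : nat) (A : set 'rV[R]_n)
    (f : 'rV[R]_n -> 'rV[R]_n) : Prop :=
  forall x, A x -> differentiable f x /\ {for x, continuous (jacobian f)}.

Definition C1_diffeo (R : realType) (n : nat) (A B : set 'rV[R]_n)
    (f : 'rV[R]_n -> 'rV[R]_n) : Prop :=
  [/\ open A, open B, set_bij A B f, C1_on A f &
      exists g : 'rV[R]_n -> 'rV[R]_n, {in A, cancel f g} /\ C1_on B g].

(* With row vectors, Phi'(p) h = h *m 'J Phi p.  Hence the adjoint of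
   Phi'(p)^-1 maps v to v *m (invmx ('J Phi p))^T. *)
Definition compl_ext (R : realType) (n : nat) (Phi : 'rV[R]_n -> 'rV[R]_n)
    (pv : 'rV[R]_n * 'rV[R]_n) : 'rV[R]_n * 'rV[R]_n :=
  (Phi pv.1, pv.2 *m (invmx ('J Phi pv.1))^T).

(* The right-hand side G : X * U -> X is represented by a total function whose
   values for x outside X are never used. *)
Fixpoint gen_sol (R : realType) (n : nat) (U : Type)
    (G : 'rV[R]_n -> U -> 'rV[R]_n) (k : nat) (x0 : 'rV[R]_n) (u : nat -> U) :
    'rV[R]_n :=
  if k is k'.+1 then G (gen_sol G k' x0 u) (u k') else x0.

(* A set C of cells is also used as the type of its elements; for D : C, the
   cell itself is [val D]. *)
Definition quantizer (R : realType) (n : nat) (C : set (set 'rV[R]_n))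
    (x : 'rV[R]_n) : set C :=
  [set D : C | (val D) x].
Arguments quantizer {R n} C x.

Definition behavior (R : realType) (n : nat) (X : set 'rV[R]_n) (U : Type)
    (G : 'rV[R]_n -> U -> 'rV[R]_n) (C : set (set 'rV[R]_n)) :
    set (nat -> U * C) :=
  [set w | exists x : nat -> 'rV[R]_n,
     (forall k, X (x k)) /\
     forall k, x k.+1 = G (x k) (w k).1 /\ quantizer C (x k) (w k).2].

(* The map S on U^[0;k[ * C^[0;k].  The argument [hat] gives the supersets of
   the cells in C', and [Sigma (hat D)] the chosen approximation; both are only
   used for cells in C'. *)
Fixpoint algS (R : realType) (n : nat) (X : set 'rV[R]_n) (U : Type)
    (G : 'rV[R]_n -> U -> 'rV[R]_n) (C C' : set (set 'rV[R]_n))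
    (hat : set 'rV[R]_n -> set 'rV[R]_n)
    (Sigma : set 'rV[R]_n -> set ('rV[R]_n * 'rV[R]_n)) (k : nat) :
    ('I_k -> U) -> ('I_k.+1 -> C) -> set ('rV[R]_n * 'rV[R]_n) :=
  match k with
  | 0 => fun _ D =>
      if `[< C' (val (D ord0)) >] then Sigma (hat (val (D ord0))) else set0
  | k'.+1 => fun u D =>
      let Sm := algS X G C' hat Sigma
                  (fun i => u (widen_ord (leqnSn k') i))
                  (fun i => D (widen_ord (leqnSn k'.+1) i)) in
      let GSm := compl_ext (G ^~ (u ord_max)) @` (Sm `&` (X `*` setT)) in
      let Dnew := val (D ord_max) in
      if `[< Sm = set0 >] then set0
      else if `[< Dnew `&` halfspaces GSm = set0 >] then setT
      else if `[< ~ C' Dnew >] then set0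
      else Sigma (hat Dnew) `|` GSm
  end.

Definition Bk (R : realType) (n : nat) (X : set 'rV[R]_n) (U : Type)
    (G : 'rV[R]_n -> U -> 'rV[R]_n) (C C' : set (set 'rV[R]_n))
    (hat : set 'rV[R]_n -> set 'rV[R]_n)
    (Sigma : set 'rV[R]_n -> set ('rV[R]_n * 'rV[R]_n)) (k : nat) :
    set (nat -> U * C) :=
  [set w | forall tau : nat,
     halfspaces (algS X G C' hat Sigma
                   (initseg k (seqshift tau (fun j => (w j).1)))
                   (initseg k.+1 (seqshift tau (fun j => (w j).2)))) !=set0].
Arguments Bk {R n} X {U} G C C' hat Sigma k.
Arguments behavior {R n} X {U} G C.

(* Main.v *)
Require Import Defs.
From mathcomp Require Import all_boot all_order all_algebra.
From mathcomp Require Import all_classical all_reals all_analysis.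
From mathcomp Require Import finmap.

Import Order.TTheory GRing.Theory Num.Theory.
Import numFieldNormedType.Exports.

Local Open Scope classical_set_scope.
Local Open Scope ring_scope.


(** Two independent facts are combined.

    The sets B_k are given by a condition on the windows of length k+1, the
    same one at every time.  Such a set is k-complete for trivial reasons
    ([local_complete]), and over a finite alphabet every k-complete behavior is
    generated by the automaton whose states are the windows of length k+1
    ([complete_discrete]).  The alphabet U * C is finite because U and C are.

    For the inclusion of the behavior in B_k, the state reached by a trajectory
    of the system is shown to lie in every half-space produced by the
    algorithm.  Such a half-space stems from a supporting half-space of the set
    assigned to some cell E of C', carried along by the complementary extension.
    By induction it contains the whole image of that set under the solution
    ([algS_supports]), and the trajectory, which visited E, lies in that image.
    The induction step is geometric: if Phi is a diffeomorphism and the image of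
    Omega is convex, then the complementary extension of a half-space supporting
    Omega at p supports the image at Phi(p) ([compl_ext_supports]).  Indeed, the
    segment from Phi(p) to a point of the image pulls back to a curve in Omega
    starting at p, whose initial velocity cannot leave the half-space. *)

Lemma seqshiftD (W : Type) (s t : nat) (w : nat -> W) :
  seqshift s (seqshift t w) = seqshift (t + s)%N w.
Proof. by apply: funext => i; rewrite /seqshift addnA. Qed.

Lemma local_complete (W : Type) (k : nat) (P : ('I_k.+1 -> W) -> Prop) :
  complete k [set w | forall tau, P (initseg k.+1 (seqshift tau w))].
Proof.
apply/seteqP; split=> w /= wB tau.
  by exists (seqshift tau w) => //= s; rewrite seqshiftD.
by have [w' /(_ 0%N) w'P <-] := wB tau.
Qed.

(** In a run of the automaton, the window held at time j need only be compatible
    with the one held at time j+1, but consecutive windows overlap so much that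
    together they must be the windows of the generated word; completeness then
    puts that word in the behavior.  The map [code] provides the finite type of
    states when the alphabet carries no such structure itself. *)
Lemma complete_discrete (W : Type) (F : finType) (code : W -> F)
    (code_inj : injective code) (k : nat) (B : set (nat -> W)) :
  complete k B -> discrete B.
Proof.
move=> cB.
have memB w : (forall tau, (initseg k.+1 @` B) (initseg k.+1 (seqshift tau w)))
    -> B w.
  by move=> h; rewrite cB.
have shiftB w tau : B w -> B (seqshift tau w).
  by move=> Bw; apply: memB => s; rewrite seqshiftD; rewrite cB in Bw.
pose window (v : nat -> W) : {ffun 'I_k.+1 -> F} :=
  [ffun i => code (initseg k.+1 v i)].
pose step (q : {ffun 'I_k.+1 -> F}) (a : W) (q' : {ffun 'I_k.+1 -> F}) :=
  exists v, [/\ B v, q = window v, a = v 0%N & q' = window (seqshift 1 v)].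
exists (Automaton setT step); apply/seteqP; split=> [w Bw|w /= [q [_ runq]]].
  exists (fun j => window (seqshift j w)); split=> // j /=.
  exists (seqshift j w); split=> //; first exact: shiftB.
    by rewrite /seqshift addn0.
  by rewrite seqshiftD addn1.
have [v vP] := choice runq.
have vS j i : (i < k)%N -> v j.+1 i = v j i.+1.
  move=> ik; have [_ _ _ e] := vP j; have [_ e' _ _] := vP j.+1.
  have ik1 : (i < k.+1)%N by rewrite ltnS ltnW.
  move: e; rewrite e' => /ffunP /(_ (Ordinal ik1)); rewrite !ffunE.
  exact: code_inj.
have vw j i : (i <= k)%N -> v j i = w (j + i)%N.
  elim: i j => [|i IH] j ik; first by rewrite addn0; have [_ _ -> _] := vP j.
  by rewrite -vS // IH 1?ltnW // addSnnS.
apply: memB => tau; have [Bv _ _ _] := vP tau; exists (v tau) => //.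
by apply: funext => i; rewrite /initseg vw // -ltnS.
Qed.

Lemma dotE (R : realType) (n : nat) (u v : 'rV[R]_n) : dot u v = (u *m v^T) 0 0.
Proof. by rewrite /dot mxE; apply: eq_bigr => i _; rewrite mxE. Qed.

Lemma dotZr (R : realType) (n : nat) (a : R) (u v : 'rV[R]_n) :
  dot u (a *: v) = a * dot u v.
Proof. by rewrite !dotE linearZ /= -scalemxAr mxE. Qed.

Lemma dot_adjoint (R : realType) (n : nat) (u v : 'rV[R]_n) (A : 'M[R]_n) :
  dot (u *m A^T) v = dot u (v *m A).
Proof. by rewrite !dotE trmx_mul mulmxA. Qed.

Lemma dot_continuous (R : realType) (n : nat) (u : 'rV[R]_n) : continuous (dot u).
Proof.
apply: continuous_big => [|i _ x]; first exact: add_continuous.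
by apply: continuousM; [exact: cst_continuous | exact: coord_continuous].
Qed.

(** The chain rule for the composite of f and g, which is the identity near p
    because X is open.  With row vectors the Jacobians multiply in the order of
    application. *)
Lemma invmx_jacobian (R : realType) (n : nat) (X Y : set 'rV[R]_n)
    (f g : 'rV[R]_n -> 'rV[R]_n) (p : 'rV[R]_n) :
  open X -> X p -> {in X, cancel f g} ->
  differentiable f p -> differentiable g (f p) ->
  invmx ('J f p) = 'J g (f p).
Proof.
move=> oX Xp fK df dg.
have JJ : 'J f p *m 'J g (f p) = 1%:M.
  apply/row_matrixP => i; rewrite row_mul rowE row1 /jacobian !mul_rV_lin1.
  have gf : 'D_('e_i) (g \o f) p = 'e_i.
    rewrite -[RHS](@derive_id R 'rV[R]_n p); apply: near_eq_derive.
    apply: filterS (open_nbhs_nbhs (conj oX Xp)) => x Xx /=.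
    by apply: fK; exact: mem_set.
  rewrite -[RHS]gf deriveE; last exact: differentiable_comp.
  by rewrite [in RHS](diff_comp df dg).
have [uJ _] := mulmx1_unit JJ.
by rewrite -[LHS]mulmx1 -JJ mulmxA mulVmx // mul1mx.
Qed.

(** For y in the image of Omega, convexity makes f(p) + t (y - f(p)) the image of
    a point of Omega for t in ]0; 1].  Hence the difference quotients at f(p) of
    the inverse g in direction y - f(p) have nonpositive product with v, and so
    does their limit, the derivative.  By adjunction this is the product of
    y - f(p) with the transported normal. *)
Lemma compl_ext_supports (R : realType) (n : nat) (X Y Omega : set 'rV[R]_n)
    (f : 'rV[R]_n -> 'rV[R]_n) (p v : 'rV[R]_n) :
  C1_diffeo X Y f -> Omega `<=` X -> convex_set (f @` Omega) ->
  Omega p -> Omega `<=` halfspace p v ->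
  f @` Omega `<=` halfspace (compl_ext f (p, v)).1 (compl_ext f (p, v)).2.
Proof.
move=> [oX oY [fXY _ _] C1f [g [fK C1g]]] OX cvx Op Ov y Oy.
have Xp := OX _ Op.
have dg : differentiable g (f p) by case: (C1g (f p) (fXY _ Xp)).
rewrite /halfspace /compl_ext /= dot_adjoint.
rewrite (@invmx_jacobian _ _ X Y f g) //; last by case: (C1f p Xp).
rewrite /jacobian mul_rV_lin1 -deriveE //.
have gfp : g (f p) = p by apply: fK; exact: mem_set.
pose quot (t : R) := t^-1 *: (g (t *: (y - f p) + f p) - g (f p)).
have quot_cvg : quot t @[t --> 0^'+] --> 'D_(y - f p) g (f p).
  apply: cvg_dnbhs_at_right; exact: (diff_derivable dg).
have dot_cvg : dot v (quot t) @[t --> 0^'+] --> dot v ('D_(y - f p) g (f p)).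
  exact: (cvg_comp _ _ quot_cvg (@dot_continuous _ _ v _)).
rewrite -(cvg_lim _ dot_cvg) //.
apply: limr_le; first by apply: cvgP dot_cvg.
apply: filterS2 (nbhs_right_gt 0) (nbhs_right_le ltr01) => t t0 t1.
have [a Oa fa] : (f @` Omega) (t *: (y - f p) + f p).
  have fpO : f p \in f @` Omega by apply: mem_set; exists p.
  rewrite [X in _ X](_ : _ = conv (Itv01 (ltW t0) t1)
    (y : convex_lmodType 'rV[R]_n) (f p : convex_lmodType 'rV[R]_n)).
    exact: set_mem (cvx _ _ _ (mem_set Oy) fpO).
  by rewrite /conv /= scalerBr scalerBl scale1r addrAC addrA.
rewrite /quot gfp -fa (fK _ (mem_set (OX _ Oa))).
by rewrite dotZr pmulr_rle0 ?invr_gt0 //; exact: Ov.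
Qed.

Lemma gen_sol_in (R : realType) (n : nat) (X : set 'rV[R]_n) (U : Type)
    (G : 'rV[R]_n -> U -> 'rV[R]_n) (k : nat) (x : 'rV[R]_n) (u : nat -> U) :
  (forall x w, X x -> X (G x w)) -> X x -> X (gen_sol G k x u).
Proof. by move=> GX Xx; elim: k => //= k IH; exact: GX. Qed.

(** The set reached at time k from the states in A at time k - j, under the
    inputs u_(k-j), ..., u_(k-1). *)
Definition transported_set (R : realType) (n : nat) (U : Type)
    (G : 'rV[R]_n -> U -> 'rV[R]_n) (u : nat -> U) (k j : nat)
    (A : set 'rV[R]_n) : set 'rV[R]_n :=
  [set gen_sol G j z (seqshift (k - j)%N u) | z in A].

Arguments transported_set {R n U} G u k j A.

Lemma transported_set0 (R : realType) (n : nat) (U : Type)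
    (G : 'rV[R]_n -> U -> 'rV[R]_n) (u : nat -> U) (k : nat)
    (A : set 'rV[R]_n) :
  transported_set G u k 0 A = A.
Proof. exact: image_id. Qed.

Lemma transported_setS (R : realType) (n : nat) (U : Type)
    (G : 'rV[R]_n -> U -> 'rV[R]_n) (u : nat -> U) (k j : nat)
    (A : set 'rV[R]_n) :
  (j <= k)%N ->
  transported_set G u k.+1 j.+1 A = G ^~ (u k) @` transported_set G u k j A.
Proof.
by move=> jk; rewrite /transported_set image_comp subSS /= /seqshift subnK.
Qed.

(** The invariant of the algorithm along a trajectory x: each half-space computed
    at time k supports, at a point p of it, a set that has been carried along
    for j steps and contains x_k.  Remembering this set, and not only that x_k
    satisfies the inequality, is what makes the induction work: after one more
    step the set is again the image of an assigned superset, hence convex, and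
    the transported half-space supports it. *)
Lemma algS_supports (R : realType) (n N : nat)
    (X : set 'rV[R]_n)
    (U : Type)
    (G : 'rV[R]_n -> U -> 'rV[R]_n)
    (G_into : forall x w, X x -> X (G x w))
    (G_diffeo : forall w, exists Y : set 'rV[R]_n,
        Y `<=` X /\ C1_diffeo X Y (G ^~ w))
    (C C' : set (set 'rV[R]_n))
    (hat : set 'rV[R]_n -> set 'rV[R]_n)
    (hat_sup : forall D, C' D -> D `<=` hat D)
    (hat_sub : forall D, C' D -> hat D `<=` X)
    (hat_convex : forall D, C' D -> forall (k : nat) (u : nat -> U),
        (1 <= k <= N)%N ->
        convex_set [set gen_sol G k x u | x in hat D])
    (Sigma : set 'rV[R]_n -> set ('rV[R]_n * 'rV[R]_n))
    (Sigma_approx : forall D, C' D ->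
        supporting_convex_approx (hat D) (Sigma (hat D)))
    (x : nat -> 'rV[R]_n) (u : nat -> U) (D : nat -> C)
    (xG : forall i, x i.+1 = G (x i) (u i))
    (xD : forall i, quantizer C (x i) (D i)) (k : nat) :
  (k <= N)%N ->
  forall p v, algS X G C' hat Sigma (initseg k u) (initseg k.+1 D) (p, v) ->
  exists j E, [/\ (j <= k)%N, C' E, transported_set G u k j (hat E) (x k),
    transported_set G u k j (hat E) p
    & transported_set G u k j (hat E) `<=` halfspace p v].
Proof.
pose supported i p v := exists j E, [/\ (j <= i)%N, C' E,
  transported_set G u i j (hat E) (x i), transported_set G u i j (hat E) p
  & transported_set G u i j (hat E) `<=` halfspace p v].
have start i p v : C' (val (D i)) -> Sigma (hat (val (D i))) (p, v) ->
    supported i p v.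
  move=> C'D Spv; have [hp [_ hv]] := Sigma_approx _ C'D _ _ Spv.
  exists 0%N, (val (D i)); rewrite transported_set0; split=> //.
  exact/hat_sup/xD.
elim: k => [|k IH] kN p v; rewrite -/(supported _ p v) /=.
  by case: asboolP => // C'D; exact: start.
set Sm := algS _ _ _ _ _ _ _; set GSm := compl_ext _ @` _.
have step p1 v1 : GSm (p1, v1) -> supported k.+1 p1 v1.
  move=> [[q w] [Smqw _] [<- <-]].
  have [j [E [jk C'E Ox Oq Oqw]]] := IH (ltnW kN) _ _ Smqw.
  have [Y [_ dY]] := G_diffeo (u k).
  exists j.+1, E; split=> //.
  - by rewrite transported_setS // xG; exists (x k).
  - by rewrite transported_setS //; exists q.
  - rewrite transported_setS //; apply: (@compl_ext_supports _ _ X Y) => //.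
      by move=> _ [z Ez <-]; apply: gen_sol_in => //; exact: hat_sub Ez.
    by rewrite -transported_setS //; apply: hat_convex; rewrite ?(leq_ltn_trans jk).
have xGSm : halfspaces GSm (x k.+1).
  by move=> [p1 v1] /step [j [E [_ _ Ox _]]]; exact.
(* The next state lies in its cell and in the propagated polyhedron, so the case
   of an empty intersection does not arise along a trajectory. *)
case: asboolP => // _; case: asboolP => [/seteqP [+ _]|_].
  by move=> /(_ (x k.+1)) []; split=> //; exact: xD.
by case: asboolP => // /contrapT C'D [/start|/step]; exact.
Qed.

Theorem mainTheorem1 (R : realType) (n N : nat) (n_gt0 : (0 < n)%N)
    (X : set 'rV[R]_n) (X_open : open X)
    (U : finType)
    (G : 'rV[R]_n -> U -> 'rV[R]_n)
    (G_into : forall x w, X x -> X (G x w))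
    (G_diffeo : forall w, exists Y : set 'rV[R]_n,
        Y `<=` X /\ C1_diffeo X Y (G ^~ w))
    (C : set (set 'rV[R]_n))
    (C_finite : finite_set C)
    (C_cover : \bigcup_(D in C) D = setT)
    (C_cells : forall D, C D -> D !=set0 /\ convex_polyhedron D)
    (C' : set (set 'rV[R]_n)) (C'_sub : C' `<=` C)
    (hat : set 'rV[R]_n -> set 'rV[R]_n)
    (hat_sup : forall D, C' D -> D `<=` hat D)
    (hat_sub : forall D, C' D -> hat D `<=` X)
    (hat_convex : forall D, C' D -> forall (k : nat) (u : nat -> U),
        (1 <= k <= N)%N ->
        convex_set [set gen_sol G k x u | x in hat D])
    (Sigma : set 'rV[R]_n -> set ('rV[R]_n * 'rV[R]_n))
    (Sigma_approx : forall D, C' D ->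
        supporting_polyhedral_approx (hat D) (Sigma (hat D))) :
  forall k : nat, (k <= N)%N ->
    [/\ complete k (Bk X G C C' hat Sigma k),
        discrete (Bk X G C C' hat Sigma k)
      & abstraction (behavior X G C) (Bk X G C C' hat Sigma k)].
Proof.
move=> k kN.
(* Membership in B_k is a condition on windows of k+1 pairs that ignores the
   last input. *)
have Bk_complete : complete k (Bk X G C C' hat Sigma k).
  exact: (@local_complete _ k (fun z => halfspaces (algS X G C' hat Sigma
    (fun i => (z (widen_ord (leqnSn k) i)).1) (fun i => (z i).2)) !=set0)).
split=> //.
- have inC (D : C) : val D \in fset_set C by rewrite in_fset_set //; exact: valP.
  apply: (@complete_discrete _ (U * fset_set C)%type
    (fun a => (a.1, FSetSub (inC a.2)))) Bk_complete.
  by move=> [w D] [w' D'] /= [-> /val_inj ->].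
- move=> w [x [_ xw]] tau; exists (x (tau + k)%N) => -[p v].
  move=> /(@algS_supports _ _ N X U G G_into G_diffeo C C' hat hat_sup hat_sub
    hat_convex Sigma _ (seqshift tau x)) [] //.
  + by move=> D /Sigma_approx [].
  + by move=> i; rewrite /seqshift addnS; case: (xw (tau + i)%N).
  + by move=> i; case: (xw (tau + i)%N).
  + by move=> j [E [_ _ Ox _]]; exact.
Qed.
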